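(* For every integer $k \ge 0$, every outer $k$-planar graph has treewidth at most $1.5k + 2$.
   Context: A convex drawing of a finite simple graph $G$ places the vertices of $G$ at distinct points of a circle and draws every edge as a straight-line segment. A convex drawing is outer $k$-planar if every edge crosses at most $k$ other edges. A graph is outer $k$-planar if it admits an outer $k$-planar drawing. *)

(* Defs.v *)
From HB Require Import structures.
From mathcomp Require Import all_boot all_order all_algebra.
From mathcomp Require Import boolp reals.

Set Implicit Arguments.
Unset Strict Implicit.
Unset Printing Implicit Defensive.

Import Order.TTheory GRing.Theory Num.Theory.

Local Open Scope ring_scope.

Record sgraph := SGraph {
  vertex :> finType;
  adj : rel vertex;
  adj_sym : symmetric adj;
  adj_irrefl : irreflexive adj }.

Definition edges (G : sgraph) : {set {set G}} :=
  [set [set uv.1; uv.2] | uv : G * G & adj uv.1 uv.2].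

Section ConvexDrawing.
Variables (R : realType) (G : sgraph).

Definition on_circle (c : R * R) (r : R) (p : R * R) : Prop :=
  (p.1 - c.1) ^+ 2 + (p.2 - c.2) ^+ 2 = r ^+ 2.

Record convex_drawing := ConvexDrawing {
  pos :> G -> R * R;
  center : R * R;
  radius : R;
  radius_gt0 : 0 < radius;
  pos_on_circle : forall v, on_circle center radius (pos v);
  pos_inj : injective pos }.

Definition in_open_segment (a b p : R * R) : Prop :=
  exists2 t : R, 0 < t < 1
    & p = ((1 - t) * a.1 + t * b.1, (1 - t) * a.2 + t * b.2).

Definition in_edge_interior (d : convex_drawing) (e : {set G}) (p : R * R)
    : Prop :=
  exists u v : G, e = [set u; v] /\ in_open_segment (d u) (d v) p.

(* Endpoints are excluded, so that edges meeting only at a common endpoint do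
   not cross. *)
Definition crosses (d : convex_drawing) (e f : {set G}) : Prop :=
  e <> f /\ exists p, in_edge_interior d e p /\ in_edge_interior d f p.

Definition outer_k_planar_drawing (k : nat) (d : convex_drawing) : Prop :=
  forall e, e \in edges G ->
    (#|[set f in edges G | `[< crosses d e f >]]| <= k)%N.

Definition outer_k_planar (k : nat) : Prop :=
  exists d : convex_drawing, outer_k_planar_drawing k d.

End ConvexDrawing.

Definition is_tree (T : sgraph) : Prop :=
  [/\ (0 < #|T|)%N,
      forall s t : T, connect (@adj T) s t
    & forall c : seq T, (2 < size c)%N -> ~ ucycle (@adj T) c].

Record tree_decomposition (G : sgraph) := TreeDecomposition {
  td_tree : sgraph;
  td_treeP : is_tree td_tree;
  bag : td_tree -> {set G};
  bag_vertex : forall v : G, exists t, v \in bag t;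
  bag_edge : forall u v : G, adj u v ->
    exists t, (u \in bag t) && (v \in bag t);
  bag_connected : forall (v : G) (s t : td_tree),
    v \in bag s -> v \in bag t ->
    connect [rel a b | [&& adj a b, v \in bag a & v \in bag b]] s t }.

(* The predecessor is truncated, so the graph without vertices gets width 0
   instead of -1; all other graphs have a nonempty bag. *)
Definition width (G : sgraph) (D : tree_decomposition G) : nat :=
  (\max_(t : td_tree D) #|bag t|).-1.

Section Treewidth.
Variable G : sgraph.

Definition one_vertex : sgraph :=
  @SGraph unit (fun _ _ => false) (fun _ _ => erefl) (fun _ => erefl).

Lemma one_vertex_tree : is_tree one_vertex.
Proof.
split; first by rewrite card_unit.
- by case; case; exact: connect0.
- by case=> [|[] [|[] c]].
Qed.

Lemma one_bag_connected (v : G) (s t : one_vertex) :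
  v \in [set: G] -> v \in [set: G] ->
  connect [rel a b : one_vertex |
            [&& adj a b, v \in [set: G] & v \in [set: G]]] s t.
Proof. by move=> _ _; case: s t => -[]; exact: connect0. Qed.

Definition one_bag : tree_decomposition G.
Proof.
refine (@TreeDecomposition G one_vertex one_vertex_tree (fun=> [set: G])
  _ _ one_bag_connected).
- by move=> v; exists tt; rewrite in_setT.
- by move=> u v _; exists tt; rewrite !in_setT.
Defined.

Lemma width_exists :
  exists w, `[< exists D : tree_decomposition G, width D = w >].
Proof. by exists (width one_bag); apply/asboolP; exists one_bag. Qed.

Definition treewidth : nat := ex_minn width_exists.

End Treewidth.

(* Main.v *)
(** Index the vertices along the circle.  A chord of the polygon crossed by at
    most k edges can be completed to a triangle whose two other sides are also
    crossed by at most k edges, so the polygon has a triangulation in which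
    every side is crossed at most k times.  The tree decomposition follows the
    dual tree of this triangulation: the bag of a triangle consists of its three
    corners and of the lower endpoint of each edge that crosses two of its
    sides, hence has at most 3 + 3k/2 elements.  Between two triangles sharing
    a side, bags with the lower endpoints of the edges crossing that side and
    one opposite corner have at most k + 3 elements. *)

Require Import Defs.
From HB Require Import structures.
From mathcomp Require Import all_boot all_order all_algebra.
From mathcomp Require Import boolp reals.
From mathcomp Require Import zify ring lra.

Set Implicit Arguments.
Unset Strict Implicit.
Unset Printing Implicit Defensive.

Import Order.TTheory GRing.Theory Num.Theory.

Local Open Scope ring_scope.

(** * Tree decompositions built leaf by leaf *)

Lemma homo_connect (T T' : finType) (e : rel T) (e' : rel T') (f : T -> T') :
  {homo f : x y / e x y >-> e' x y} ->
  {homo f : x y / connect e x y >-> connect e' x y}.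
Proof.
move=> fe x y /connectP[p]; elim: p x => [|z p IHp] x /= => [_ ->|].
  exact: connect0.
case/andP=> exz pz def_y; apply: connect_trans (connect1 (fe _ _ exz)) _.
exact: IHp.
Qed.

Section AddLeaf.
Variables (T : sgraph) (t : T).

Definition leaf_adj (x y : option T) : bool :=
  match x, y with
  | Some a, Some b => adj a b
  | Some a, None | None, Some a => a == t
  | None, None => false
  end.

Lemma leaf_adj_sym : symmetric leaf_adj.
Proof. by case=> [a|] [b|] //=; exact: adj_sym. Qed.

Lemma leaf_adj_irrefl : irreflexive leaf_adj.
Proof. by case=> [a|] //=; exact: adj_irrefl. Qed.

Definition add_leaf : sgraph := SGraph leaf_adj_sym leaf_adj_irrefl.

(** Both neighbours of [None] on a cycle would be [t], against uniqueness; a cycle avoiding [None]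
    already lies in [T]. *)
Lemma add_leaf_tree : is_tree T -> is_tree add_leaf.
Proof.
case=> cT connT acT.
have connS (x y : T) : connect (@adj add_leaf) (Some x) (Some y).
  by apply: (homo_connect (e := @adj T)) (connT x y).
have connN (x : T) : connect (@adj add_leaf) None (Some x).
  by apply: connect_trans (connS t x); apply: connect1; rewrite /= eqxx.
have csym := sym_connect_sym (@adj_sym add_leaf).
split=> [|x y|c c_gt2 /andP[cyc_c uniq_c]].
- by rewrite card_option.
- by case: x y => [x|] [y|] //; rewrite csym.
have [cN|cN] := boolP (None \in c).
  have [i c' def_c] := rot_to cN.
  move: cyc_c uniq_c c_gt2.
  rewrite -(rot_cycle i) -(rot_uniq i) -(size_rot i) def_c.
  case: c' {def_c} => [|x c'] //; case/lastP: c' => [|c' y] //.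
  rewrite /cycle rcons_path last_cons last_rcons => /andP[/= /andP[ex _] ey].
  case: x y ex ey => [x|] // [y|] // /eqP-> /eqP->.
  by rewrite mem_rcons !inE eqxx andbF.
have [c' def_c] : exists c', c = map some c'.
  elim: c cN {c_gt2 cyc_c uniq_c} => [|[x|] c IHc] //=; first by exists [::].
  by rewrite inE => /IHc[c' ->]; exists (x :: c').
rewrite def_c size_map in c_gt2; apply: (acT c' c_gt2); apply/andP; split.
  move: cyc_c; rewrite def_c; case: c' {def_c c_gt2} => //= x c'.
  by rewrite -map_rcons path_map.
by move: uniq_c; rewrite def_c map_inj_uniq //; apply: Some_inj.
Qed.

End AddLeaf.

(** A new bag [B] hangs off an earlier bag [P] holding all vertices of [B] already in use, which
    keeps the bags of each vertex connected. The tree stays implicit, so later arguments only handle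
    a list of bags. *)
Inductive tree_built (V : finType) : seq {set V} -> Prop :=
| built_root (B : {set V}) : tree_built [:: B]
| built_leaf (bs : seq {set V}) (P B : {set V}) :
    tree_built bs -> P \in bs ->
    (forall v, v \in B -> has (fun C : {set V} => v \in C) bs -> v \in P) ->
    tree_built (B :: bs).

Lemma tree_built_decomposition (V : finType) (bs : seq {set V}) :
  tree_built bs ->
  exists (T : sgraph) (b : T -> {set V}),
    [/\ is_tree T,
        forall t, b t \in bs,
        forall B, B \in bs -> exists t, b t = B
      & forall v s t, v \in b s -> v \in b t ->
        connect [rel x y | [&& adj x y, v \in b x & v \in b y]] s t].
Proof.
elim=> {bs} [B|bs P B _ [T [b [treeT b_bs bs_b conn]]] Pbs BP].
  exists one_vertex, (fun=> B); split; first exact: one_vertex_tree.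
  - by move=> _; rewrite inE.
  - by move=> C; rewrite inE => /eqP->; exists tt.
  - by move=> v [] [] _ _; exact: connect0.
have [t0 def_P] := bs_b _ Pbs.
pose b' (x : add_leaf t0) := if x is Some t then b t else B.
exists (add_leaf t0), b'; split; first exact: add_leaf_tree.
- by case=> [t|]; rewrite inE ?eqxx ?b_bs ?orbT.
- move=> C; rewrite inE => /orP[/eqP->|/bs_b[t <-]]; first by exists None.
  by exists (Some t).
move=> v; set e := [rel x y | _].
have connS s t : v \in b s -> v \in b t -> connect e (Some s) (Some t).
  move=> vs vt; apply: (homo_connect _ (conn v s t vs vt)).
  by move=> x y.
have csym : connect_sym e.
  by apply: sym_connect_sym => x y /=; rewrite leaf_adj_sym [X in _ && X]andbC.
have connN t : v \in B -> v \in b t -> connect e None (Some t).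
  move=> vB vt; have vt0 : v \in b t0.
    by rewrite def_P; apply: BP => //; apply/hasP; exists (b t).
  apply: connect_trans (connS t0 t vt0 vt); apply: connect1.
  by rewrite /= eqxx vB.
case=> [s|] [t|] /= vs vt; [exact: connS | | exact: connN | exact: connect0].
by rewrite csym; exact: connN.
Qed.

Lemma treewidth_le (G : sgraph) (D : tree_decomposition G) (w : nat) :
  (forall t : td_tree D, #|bag t| <= w.+1)%N -> (treewidth G <= w)%N.
Proof.
move=> leD; rewrite /treewidth; case: ex_minnP => m _ min_m.
apply: (leq_trans (min_m (width D) _)); first by apply/asboolP; exists D.
by rewrite /width -subn1 leq_subLR add1n; apply/bigmax_leqP => t _; exact: leD.
Qed.

Lemma treewidth_le_built (G : sgraph) (bs : seq {set G}) (w : nat) :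
  tree_built bs ->
  (forall v : G, exists2 B, B \in bs & v \in B) ->
  (forall u v : G, adj u v -> exists2 B, B \in bs & (u \in B) && (v \in B)) ->
  (forall B, B \in bs -> (#|B| <= w.+1)%N) ->
  (treewidth G <= w)%N.
Proof.
move=> /tree_built_decomposition[T [b [treeT b_bs bs_b conn]]] cov_v cov_e leB.
have b_v v : exists t, v \in b t.
  by have [B /bs_b[t <-]] := cov_v v; exists t.
have b_e u v : adj u v -> exists t, (u \in b t) && (v \in b t).
  by case/cov_e=> B /bs_b[t <-]; exists t.
by apply: (treewidth_le (D := TreeDecomposition treeT b_v b_e conn)) => t /=;
  exact/leB/b_bs.
Qed.

(** * Splitting a lightly crossed chord *)

Section Crossings.
Local Open Scope nat_scope.

(** For [a < b] and [i < j]: the chords [ab] and [ij] interleave, without a common endpoint. *)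
Definition straddles (a b i j : nat) : bool :=
  (a < i < b) && (b < j) || (i < a) && (a < j < b).

(** The last hypothesis says that within [ab] only [pq] and [ab] themselves enclose [pq]. The
    inequalities are checked for every order of [i] and [j] relative to the four positions; the
    coefficients 2 and 1 fit [ecount_leqD], which sums them over all edges. *)
Lemma straddles_nested (a b p q i j : nat) : a <= p < q -> q <= b -> i < j ->
  (a <= i <= p -> q <= j <= b ->
     (i == p) && (j == q) || (i == a) && (j == b)) ->
  [/\ straddles a p i j + straddles a q i j <=
        2 * ((a < i <= p) && (b < j) || (i < a) && (a < j <= p)) +
        straddles p q i j,
      straddles p b i j + straddles q b i j <=
        2 * ((q <= i < b) && (b < j) || (i < a) && (q <= j < b)) +
        straddles p q i j,
      straddles a p i j + straddles q b i j <=
        1 * straddles a b i j + straddles p q i j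
    & straddles p b i j + straddles a q i j <=
        1 * straddles a b i j + straddles p q i j].
Proof.
move=> apq qb ij nested; rewrite /straddles; split;
  have [?|?|?] := ltngtP i a; have [?|?|?] := ltngtP i p; try lia;
  have [?|?|?] := ltngtP i q; try lia; have [?|?|?] := ltngtP i b; try lia;
  have [?|?|?] := ltngtP j a; try lia; have [?|?|?] := ltngtP j p; try lia;
  have [?|?|?] := ltngtP j q; try lia; have [?|?|?] := ltngtP j b;
  rewrite /=; lia.
Qed.

Variables (G : sgraph) (h : G -> nat).

(** Requiring [h x.1 < h x.2] counts each undirected edge once. *)
Definition ecount (P : nat -> nat -> bool) : nat :=
  \sum_(x : G * G | adj x.1 x.2 && (h x.1 < h x.2)) P (h x.1) (h x.2).

Lemma ecount_card P : ecount P =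
  #|[set x : G * G | adj x.1 x.2 && (h x.1 < h x.2) & P (h x.1) (h x.2)]|.
Proof.
rewrite -sum1_card /ecount big_mkcond [RHS]big_mkcond; apply: eq_bigr => x _.
by rewrite inE; case: (_ && _) => //=; case: P.
Qed.

Lemma ecount_leq (P Q : nat -> nat -> bool) :
  (forall u v, adj u v -> h u < h v -> P (h u) (h v) -> Q (h u) (h v)) ->
  ecount P <= ecount Q.
Proof.
move=> PQ; apply: leq_sum => x /andP[adj_x lt_x].
by case: (boolP (P _ _)) => // /(PQ _ _ adj_x lt_x)->.
Qed.

Lemma ecount_leqD n (P1 P2 Q1 Q2 : nat -> nat -> bool) :
  (forall u v, adj u v -> h u < h v ->
     P1 (h u) (h v) + P2 (h u) (h v) <=
     n * Q1 (h u) (h v) + Q2 (h u) (h v)) ->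
  ecount P1 + ecount P2 <= n * ecount Q1 + ecount Q2.
Proof.
move=> PQ; rewrite /ecount big_distrr -!big_split; apply: leq_sum.
by move=> x /andP[? ?]; exact: PQ.
Qed.

Definition crossnum (a b : nat) : nat := ecount (straddles a b).

(** Take the largest [c] such that at most half of the crossing edges have their inner endpoint
    below [c]. If more than half had it above [c], then at most half would have it below [c + 1],
    against maximality. *)
Lemma crossing_median a b : a.+1 < b -> exists c,
  [/\ a < c < b,
      2 * ecount (fun i j => (a < i < c) && (b < j) || (i < a) && (a < j < c))
        <= crossnum a b
    & 2 * ecount (fun i j => (c < i < b) && (b < j) || (i < a) && (c < j < b))
        <= crossnum a b].
Proof.
set A := fun c i j => (a < i < c) && (b < j) || (i < a) && (a < j < c).
set B := fun c i j => (c < i < b) && (b < j) || (i < a) && (c < j < b).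
move=> ab; pose P c := (a < c < b) && (2 * ecount (A c) <= crossnum a b).
have P0 : exists c, P c.
  exists a.+1; rewrite /P leqnn ab /=.
  suff -> : ecount (A a.+1) = 0 by [].
  by apply: big1 => x _; rewrite /A; lia.
have leP c : P c -> c <= b by rewrite /P; lia.
case: (ex_maxnP P0 leP) => c /andP[acb leA] max_c; exists c; split=> //.
rewrite -/(B c) leqNgt; apply/negP => gtB.
have [c1b|c1b] := ltnP c.+1 b; last first.
  suff B0 : ecount (B c) = 0 by rewrite B0 in gtB.
  by apply: big1 => x _; rewrite /B; lia.
have: ~~ P c.+1 by apply/negP => /max_c; rewrite ltnn.
have: ecount (A c.+1) + ecount (B c) <= 0 * ecount (A c) + crossnum a b.
  by apply: ecount_leqD => u v _ _; rewrite /A /B /straddles; lia.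
rewrite /P; lia.
Qed.

Variable k : nat.
Hypothesis edge_crossnum :
  forall u v : G, adj u v -> h u < h v -> crossnum (h u) (h v) <= k.

(* Take c a median of the inner endpoints of the edges crossing ab.  If no edge
   on the inner side jumps over c, then c works.  Otherwise a longest such edge
   pq has no other edge enclosing it, and p or q works: in each of the four ways
   in which both could fail, the two excessive chords have together at most as
   many crossings as ab and pq (and if p = a or q = b, pq itself is a new side). *)
Lemma split_vertex a b : a.+1 < b -> crossnum a b <= k ->
  exists c, [/\ a < c < b, crossnum a c <= k & crossnum c b <= k].
Proof.
move=> ab leab; have [c [acb leA leB]] := crossing_median ab.
pose over (x : G * G) := [&& adj x.1 x.2, a <= h x.1 < c, c < h x.2 <= b &
  (h x.1 != a) || (h x.2 != b)].
have [x0 over0|no_over] := pickP over; last first.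
  exists c; split=> //; apply: leq_trans leab; apply: ecount_leq => u v euv _;
    have /= := no_over (u, v); rewrite /over /straddles /= euv /=; lia.
case: (arg_maxnP (fun x : G * G => h x.2 - h x.1) over0) => -[u v] /=.
rewrite {1}/over /=; set p := h u; set q := h v => /and4P[euv apc cqb pq] max_uv.
have {}max_uv x y : adj x y -> a <= h x <= p -> q <= h y <= b ->
  (h x == p) && (h y == q) || (h x == a) && (h y == b).
  move=> exy axp qyb; have := max_uv (x, y); rewrite /over /= exy; lia.
have lepq : crossnum p q <= k by apply: edge_crossnum => //; lia.
pose A i j := (a < i <= p) && (b < j) || (i < a) && (a < j <= p).
pose B i j := (q <= i < b) && (b < j) || (i < a) && (q <= j < b).
(* As [p < c < q], inner endpoints up to [p], or from [q] on, lie strictly on one side of the median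
   [c]. *)
have {}leA : 2 * ecount A <= crossnum a b.
  apply: leq_trans leA; rewrite leq_mul2l /=.
  by apply: ecount_leq => x y _ _; rewrite /A; lia.
have {}leB : 2 * ecount B <= crossnum a b.
  apply: leq_trans leB; rewrite leq_mul2l /=.
  by apply: ecount_leq => x y _ _; rewrite /B; lia.
have apq : a <= p < q by lia.
have qb : q <= b by lia.
have nested x y exy xy := straddles_nested apq qb xy (max_uv x y exy).
have apaq : crossnum a p + crossnum a q <= 2 * ecount A + crossnum p q.
  by apply: ecount_leqD => x y exy /(nested _ _ exy)[].
have pbqb : crossnum p b + crossnum q b <= 2 * ecount B + crossnum p q.
  by apply: ecount_leqD => x y exy /(nested _ _ exy)[].
have apqb : crossnum a p + crossnum q b <= 1 * crossnum a b + crossnum p q.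
  by apply: ecount_leqD => x y exy /(nested _ _ exy)[].
have pbaq : crossnum p b + crossnum a q <= 1 * crossnum a b + crossnum p q.
  by apply: ecount_leqD => x y exy /(nested _ _ exy)[].
move: leA leB => {max_uv nested}.
set nA := ecount A; set nB := ecount B => leA leB.
(* For [p = a], the side [aq] is the edge itself, and [pbqb] bounds the side [qb], because
   [crossnum a b] on its left absorbs [2 * nB]. *)
have [def_p|a_p] := eqVneq p a.
  exists q; rewrite def_p in lepq pbqb *; split; lia.
have [def_q|q_b] := eqVneq q b.
  exists p; rewrite def_q in lepq apaq *; split; lia.
have [p_good|p_bad] := boolP ((crossnum a p <= k) && (crossnum p b <= k)).
  by exists p; split; lia.
by exists q; split; lia.
Qed.

End Crossings.

(** * Bags along the triangulation *)

Section Bags.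
Local Open Scope nat_scope.
Variables (G : sgraph) (h : G -> nat) (k : nat).
Hypothesis h_inj : injective h.
Hypothesis edge_crossnum :
  forall u v : G, adj u v -> h u < h v -> crossnum h (h u) (h v) <= k.
Local Notation crossnum := (crossnum h).


(** Corners are given by positions, so a position without a vertex contributes nothing. *)
Definition at_ (s : seq nat) : {set G} := [set x | h x \in s].

Definition lower_ends (a b : nat) : {set G} :=
  [set x | [exists y, [&& adj x y, h x < h y & straddles a b (h x) (h y)]]].

Lemma lower_endsP a b x :
  reflect (exists y, [/\ adj x y, h x < h y & straddles a b (h x) (h y)])
          (x \in lower_ends a b).
Proof.
rewrite inE; apply: (iffP existsP) => -[y]; first by case/and3P; exists y.
by case=> *; exists y; apply/and3P.
Qed.

Lemma lower_ends_trans a b a' b' x : x \in lower_ends a b ->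
  (forall j, straddles a b (h x) j -> straddles a' b' (h x) j) ->
  x \in lower_ends a' b'.
Proof.
by case/lower_endsP=> y [xy lt_xy s] st; apply/lower_endsP; exists y; split;
  last exact: st.
Qed.

Lemma lower_ends_range a b x : x \in lower_ends a b -> (h x < b) && (h x != a).
Proof. by case/lower_endsP=> y [_ _]; rewrite /straddles; lia. Qed.

Lemma card_at_setU s (A : {set G}) : #|at_ s :|: A| <= size s + #|A|.
Proof.
apply: leq_trans (leq_card_setU _ _) _; rewrite leq_add2r cardE -(size_map h).
apply: uniq_leq_size; first by rewrite map_inj_uniq ?enum_uniq.
by move=> y /mapP[x]; rewrite mem_enum inE => hx ->.
Qed.

Lemma card_lower_ends a b : #|lower_ends a b| <= crossnum a b.
Proof.
rewrite /crossnum ecount_card; apply: leq_trans (leq_imset_card fst _).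
apply: subset_leq_card; apply/subsetP => x /lower_endsP[y [xy lt_xy s]].
by apply/imsetP; exists (x, y) => //; rewrite inE /= xy lt_xy.
Qed.

(** An element of at least two of the sets counts at least twice on the right. For the sides of a
    triangle this gives the term 3k/2. *)
Lemma card_majority (A B C : {set G}) :
  2 * #|A :&: B :|: A :&: C :|: B :&: C| <= #|A| + #|B| + #|C|.
Proof.
have cardE_sum (D : {set G}) : #|D| = \sum_x (x \in D).
  by rewrite -sum1_card big_mkcond; apply: eq_bigr => x _; case: (x \in D).
rewrite !cardE_sum big_distrr -!big_split /=.
apply: leq_sum => x _; rewrite !inE.
by case: (x \in A); case: (x \in B); case: (x \in C).
Qed.

Definition occurs (bs : seq {set G}) (x : G) :=
  has (fun B : {set G} => x \in B) bs.
Definition joined (bs : seq {set G}) (x y : G) :=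
  has (fun B : {set G} => (x \in B) && (y \in B)) bs.

(* Extends a partial tree that contains the bag of the side ab by bags for the
   triangles on the inner side of ab.  The last clause concerns the edges that
   cross ab from below: their lower endpoint is carried down to the other one. *)
Lemma tree_built_below n a b bs : b - a <= n -> a < b -> crossnum a b <= k ->
    tree_built bs -> (forall B, B \in bs -> 2 * #|B| <= 3 * k + 6) ->
    at_ [:: a; b] :|: lower_ends a b \in bs ->
    (forall x, occurs bs x -> a < h x < b -> x \in lower_ends a b) ->
  exists bs', [/\ [/\ tree_built bs', {subset bs <= bs'} &
      forall B, B \in bs' -> 2 * #|B| <= 3 * k + 6],
    forall x, occurs bs' x -> occurs bs x || (a <= h x <= b),
    forall x, a <= h x <= b -> occurs bs' x,
    forall x y, adj x y -> a <= h x -> h x < h y -> h y <= b -> joined bs' x y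
  & forall x y, adj x y -> h x < a -> a < h y < b -> joined bs' x y].
Proof.
elim: n a b bs => [|n IHn] a b bs le_n ab leab bsT bsk Sbs bs_in; first by lia.
have [b_eq|a1b] : b = a.+1 \/ a.+1 < b by lia.
  exists bs; split=> [|x occ|x hx|x y xy ax lt_xy yb|x y]; try lia.
  - by split.
  - apply/hasP; exists (at_ [:: a; b] :|: lower_ends a b) => //.
    rewrite !inE; lia.
  - apply/hasP; exists (at_ [:: a; b] :|: lower_ends a b) => //.
    rewrite !inE; lia.
have [c [acb leac lecb]] := split_vertex edge_crossnum a1b leab.
pose corners := at_ [:: a; b; c].
pose T := corners :|: (lower_ends a b :&: lower_ends a c :|:
  lower_ends a b :&: lower_ends c b :|: lower_ends a c :&: lower_ends c b).
(* The bags with three corners around [T] also cover edges ending at a corner: [bs1] those from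
   below [a] to [c], and [bs3] those from between [a] and [c] to [b]. Edges from [a] into [cb] need
   no such bag, since [a] is then itself in [lower_ends c b]. *)
pose bs1 := (corners :|: lower_ends a b) :: bs.
pose bs2 := T :: bs1.
pose bs3 := (corners :|: lower_ends a c) :: bs2.
pose bs4 := (at_ [:: a; c] :|: lower_ends a c) :: bs3.
have L1 x : x \in lower_ends a b -> a < h x < c -> x \in lower_ends a c.
  by move=> xI xac; apply: lower_ends_trans xI _; rewrite /straddles; lia.
have L2 x : x \in lower_ends a b -> c < h x < b -> x \in lower_ends c b.
  by move=> xI xac; apply: lower_ends_trans xI _; rewrite /straddles; lia.
have L3 x : x \in lower_ends a c -> h x < a -> x \in lower_ends a b.
  by move=> xI xac; apply: lower_ends_trans xI _; rewrite /straddles; lia.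
have L4 x : x \in lower_ends c b -> h x < a -> x \in lower_ends a b.
  by move=> xI xac; apply: lower_ends_trans xI _; rewrite /straddles; lia.
have L5 x : x \in lower_ends c b -> a < h x < c -> x \in lower_ends a c.
  by move=> xI xac; apply: lower_ends_trans xI _; rewrite /straddles; lia.
(* Packed as one boolean formula, so that [lia] can decide the leaf conditions below. *)
have facts x : [&& (x \in lower_ends a b) ==> (h x < b) && (h x != a),
    (x \in lower_ends a c) ==> (h x < c) && (h x != a),
    (x \in lower_ends c b) ==> (h x < b) && (h x != c),
    (x \in lower_ends a b) ==> (a < h x < c) ==> (x \in lower_ends a c),
    (x \in lower_ends a b) ==> (c < h x < b) ==> (x \in lower_ends c b),
    (x \in lower_ends a c) ==> (h x < a) ==> (x \in lower_ends a b),
    (x \in lower_ends c b) ==> (h x < a) ==> (x \in lower_ends a b)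
  & (x \in lower_ends c b) ==> (a < h x < c) ==> (x \in lower_ends a c)].
  by repeat (apply/andP; split); repeat (apply/implyP => ?);
    eauto using lower_ends_range.
have inS x s a' b' : (x \in at_ s :|: lower_ends a' b') =
    (h x \in s) || (x \in lower_ends a' b') by rewrite 2!inE.
have inT x : (x \in T) = [|| (h x \in [:: a; b; c]),
  (x \in lower_ends a b) && (x \in lower_ends a c),
  (x \in lower_ends a b) && (x \in lower_ends c b) |
  (x \in lower_ends a c) && (x \in lower_ends c b)].
  by rewrite /T in_setU [x \in corners]inE !in_setU !in_setI -orbA.
have occ_in x : occurs bs x ==> (a < h x < b) ==> (x \in lower_ends a b).
  by apply/implyP=> ?; apply/implyP; exact: bs_in.
have built1 : tree_built bs1.
  apply: built_leaf bsT Sbs _ => x; rewrite -/(occurs bs x) !inS.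
  have := facts x; have := occ_in x; rewrite !inE; lia.
have built2 : tree_built bs2.
  apply: (built_leaf built1 (mem_head _ _)) => x.
  rewrite /= -/(occurs bs x) inT !inS.
  have := facts x; have := occ_in x; rewrite !inE; lia.
have built3 : tree_built bs3.
  apply: (built_leaf built2 (mem_head _ _)) => x.
  rewrite /= -/(occurs bs x) inT !inS.
  have := facts x; have := occ_in x; rewrite !inE; lia.
have built4 : tree_built bs4.
  apply: (built_leaf built3 (mem_head _ _)) => x.
  rewrite /= -/(occurs bs x) inT !inS.
  have := facts x; have := occ_in x; rewrite !inE; lia.
have bsk4 B : B \in bs4 -> 2 * #|B| <= 3 * k + 6.
  have := card_lower_ends a b; have := card_lower_ends a c.
  have := card_lower_ends c b => leC1 leC2 leC3.
  rewrite !inE => /or4P[/eqP-> | /eqP-> | /eqP-> | /orP[/eqP-> | /bsk]] //.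
  - have /= := card_at_setU [:: a; c] (lower_ends a c); lia.
  - have := card_at_setU [:: a; b; c] (lower_ends a c); rewrite -/corners /=; lia.
  - have := card_majority (lower_ends a b) (lower_ends a c) (lower_ends c b).
    rewrite /T; set M := _ :|: _ :|: _.
    have := card_at_setU [:: a; b; c] M; rewrite -/corners /=; lia.
  - have := card_at_setU [:: a; b; c] (lower_ends a b); rewrite -/corners /=; lia.
have in4 x : occurs bs4 x -> a < h x < c -> x \in lower_ends a c.
  rewrite /= -/(occurs bs x) inT !inS.
  have := facts x; have := occ_in x; rewrite !inE; lia.
have ac_n : c - a <= n by lia.
have ac : a < c by lia.
have [bs5 [[built5 sub5 bsk5] occ5 cov5 edge5 cross5]] :=
  IHn a c bs4 ac_n ac leac built4 bsk4 (mem_head _ _) in4.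
pose bs6 := (at_ [:: c; b] :|: lower_ends c b) :: bs5.
have built6 : tree_built bs6.
  (* The second side also hangs off [T]: by [occ5] the part below [ac] adds only vertices between
     [a] and [c], and those in [lower_ends c b] are corners or, by [L5], in [T]. *)
  apply: (built_leaf built5 (sub5 T _)) => [|x].
    by rewrite !inE eqxx !orbT.
  move=> xS /occ5; move: xS; rewrite /= -/(occurs bs x) inT !inS.
  have := facts x; have := occ_in x; rewrite !inE; lia.
have bsk6 B : B \in bs6 -> 2 * #|B| <= 3 * k + 6.
  rewrite inE => /orP[/eqP->|/bsk5] //.
  have := card_lower_ends c b.
  have /= := card_at_setU [:: c; b] (lower_ends c b); lia.
have in6 x : occurs bs6 x -> c < h x < b -> x \in lower_ends c b.
  case/orP=> [|/occ5]; rewrite /= -/(occurs bs x) ?inT !inS;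
  have := facts x; have := occ_in x; rewrite !inE; lia.
have cb_n : b - c <= n by lia.
have cb : c < b by lia.
have [bs7 [[built7 sub7 bsk7] occ7 cov7 edge7 cross7]] :=
  IHn c b bs6 cb_n cb lecb built6 bsk6 (mem_head _ _) in6.
have sub57 : {subset bs5 <= bs7} by move=> B B5; rewrite sub7 // inE B5 orbT.
have sub47 : {subset bs4 <= bs7} by move=> B /sub5/sub57.
have sub_has (P : pred {set G}) bs' :
    {subset bs' <= bs7} -> has P bs' -> has P bs7.
  by move=> sub /hasP[B /sub B7 PB]; apply/hasP; exists B.
exists bs7; split.
- by split=> // B Bbs; rewrite sub47 // !inE Bbs !orbT.
- have occ_S x : (x \in lower_ends a b) ==> occurs bs x.
    apply/implyP => xI; apply/hasP.
    exists (at_ [:: a; b] :|: lower_ends a b) => //.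
    by rewrite inS xI orbT.
  move=> x /occ7 /orP[/orP[|/occ5]|]; rewrite /= -/(occurs bs x) ?inT ?inS;
    have := facts x; have := occ_S x; rewrite ?inE; lia.
- move=> x axb; have [xc|cx] := leqP (h x) c; last by apply: cov7; lia.
  by apply: sub_has sub57 _; apply: cov5; lia.
- move=> x y xy ax lt_xy yb; have [yc|cy] := leqP (h y) c.
    by apply: sub_has sub57 _; apply: edge5.
  have [cx|xc] := leqP c (h x); first exact: edge7.
  (* Now [h x < c < h y]. If [h y < b], the edge crosses [cb] from below and is covered there;
     otherwise it ends at the corner [b]. *)
  have [yb'|y_b] := ltnP (h y) b; first by apply: cross7; rewrite ?cy.
  have def_y : h y = b by lia.
  apply: sub_has sub47 _.
  have [x_a|x_a] := eqVneq (h x) a.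
    apply/hasP; exists T; first by rewrite !inE eqxx !orbT.
    by rewrite !inT !inE x_a def_y !eqxx !orbT.
  have xI : x \in lower_ends a c.
    by apply/lower_endsP; exists y; split; rewrite /straddles; lia.
  apply/hasP; exists (corners :|: lower_ends a c).
    by rewrite !inE eqxx !orbT.
  by rewrite !inS xI orbT def_y !inE eqxx !orbT.
- move=> x y xy xa /andP[ay yb]; have [cy|yc] := ltnP c (h y).
    by apply: cross7; lia.
  have [yc'|y_c] := ltnP (h y) c.
    by apply: sub_has sub57 _; apply: cross5; rewrite ?ay.
  have def_y : h y = c by lia.
  have xI : x \in lower_ends a b.
    by apply/lower_endsP; exists y; split; rewrite /straddles; lia.
  apply: sub_has sub47 _; apply/hasP; exists (corners :|: lower_ends a b).
    by rewrite !inE eqxx !orbT.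
  by rewrite !inS xI orbT def_y !inE eqxx !orbT.
Qed.

End Bags.
(** The recursion starts from the virtual side from 0 to [N], where [N] exceeds all positions, so no
    edge crosses it. Bags of size at most (3k + 6)/2 give width at most (3k + 4)/2. *)
Lemma treewidth_le_crossnum (G : sgraph) (h : G -> nat) (k : nat) :
  injective h ->
  (forall u v : G, adj u v -> h u < h v -> crossnum h (h u) (h v) <= k)%N ->
  (treewidth G <= (3 * k + 4)./2)%N.
Proof.
move=> h_inj lek; pose N := (\max_v h v).+1.
have ltN v : (h v < N)%N by rewrite ltnS; exact: leq_bigmax.
have cross0 : crossnum h 0 N = 0%N.
  apply: big1 => x _; rewrite /straddles.
  by have := ltN x.1; have := ltN x.2; lia.
have leN : (crossnum h 0 N <= k)%N by rewrite cross0.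
pose B0 := at_ h [:: 0; N] :|: lower_ends h 0 N.
have B0k B : B \in [:: B0] -> (2 * #|B| <= 3 * k + 6)%N.
  rewrite inE => /eqP->.
  have /= := card_at_setU h_inj [:: 0; N]%N (lower_ends h 0 N).
  have := card_lower_ends h 0 N; rewrite cross0 -/B0; lia.
have B0_in x : occurs [:: B0] x -> (0 < h x < N)%N -> x \in lower_ends h 0 N.
  by rewrite /occurs /= !inE; have := ltN x; lia.
have [bs [[built _ bsk] _ cov join _]] := tree_built_below h_inj lek
  (leqnn _) (isT : (0 < N)%N) leN (built_root B0) B0k (mem_head _ _) B0_in.
apply: (treewidth_le_built built) => [v|u v uv|B /bsk]; last by lia.
  by have /hasP[B Bbs vB] := cov v (ltnW (ltN v)); exists B.
have [uv_lt|vu_lt|/h_inj eq_uv] := ltngtP (h u) (h v).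
- have /hasP[B Bbs uvB] := join u v uv isT uv_lt (ltnW (ltN v)).
  by exists B.
- rewrite adj_sym in uv.
  have /hasP[B Bbs uvB] := join v u uv isT vu_lt (ltnW (ltN u)).
  by exists B; rewrite // andbC.
- by rewrite eq_uv adj_irrefl in uv.
Qed.

(** * Interleaved chords of a circle cross *)

Section CircleParametrization.
Variable R : realType.
Implicit Types c n p : R * R.

(* Inverse of the stereographic projection from the point n of the circle with
   center c: the second intersection with the circle of the line through n with
   direction (c - n) + t J(c - n), where J is the rotation by a right angle. *)
Definition circle_point c n (t : R) : R * R :=
  (n.1 + 2 * ((c.1 - n.1) - t * (c.2 - n.2)) / (1 + t ^+ 2),
   n.2 + 2 * ((c.2 - n.2) + t * (c.1 - n.1)) / (1 + t ^+ 2)).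

Lemma circle_pointP c r n p : 0 < r ->
  on_circle c r n -> on_circle c r p -> p <> n ->
  exists t, p = circle_point c n t.
Proof.
case: c n p => [c1 c2] [n1 n2] [p1 p2] r_gt0.
rewrite /on_circle /= => on_n on_p pn.
(* [x] and [y] are the inner products of p - n with J(c - n) and c - n, so the parameter is [x / y].
   As both points lie on the circle, 2y is the squared distance from n to p, hence nonzero. *)
pose x := (p2 - n2) * (c1 - n1) - (p1 - n1) * (c2 - n2).
pose y := (p1 - n1) * (c1 - n1) + (p2 - n2) * (c2 - n2).
have def_y : (p1 - n1) ^+ 2 + (p2 - n2) ^+ 2 = 2 * y by rewrite /y; nra.
have y_neq0 : y != 0.
  apply/eqP => y0; apply: pn; move: def_y; rewrite y0 mulr0 => /eqP.
  by rewrite paddr_eq0 ?sqr_ge0 // !sqrf_eq0 !subr_eq0 => /andP[/eqP-> /eqP->].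
have r_neq0 : r != 0 by rewrite gt_eqF.
have def_xy : x ^+ 2 + y ^+ 2 = 2 * y * r ^+ 2.
  by rewrite -def_y -on_n /x /y; ring.
have def_t : 1 + (x / y) ^+ 2 = 2 * r ^+ 2 / y.
  have -> : 1 + (x / y) ^+ 2 = (x ^+ 2 + y ^+ 2) / y ^+ 2 by field.
  by rewrite def_xy; field.
exists (x / y); rewrite /circle_point def_t; congr pair => /=.
  have -> : 2 * (c1 - n1 - x / y * (c2 - n2)) / (2 * r ^+ 2 / y) =
            (y * (c1 - n1) - x * (c2 - n2)) / r ^+ 2 by field; rewrite r_neq0.
  apply: (mulIf (expf_neq0 2 r_neq0)); rewrite mulrDl divfK ?expf_neq0 //.
  by rewrite -on_n /x /y; ring.
have -> : 2 * (c2 - n2 + x / y * (c1 - n1)) / (2 * r ^+ 2 / y) =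
          (y * (c2 - n2) + x * (c1 - n1)) / r ^+ 2 by field; rewrite r_neq0.
apply: (mulIf (expf_neq0 2 r_neq0)); rewrite mulrDl divfK ?expf_neq0 //.
by rewrite -on_n /x /y; ring.
Qed.

(* Up to the positive weights 1 + t^2 the points lie on the conic (1, t, t^2), on
   which four points satisfy the affine relation whose coefficients are the 3x3
   Vandermonde minors m, with alternating signs. *)
Lemma circle_point_crossing c n (t1 t2 t3 t4 : R) :
  t1 < t2 -> t2 < t3 -> t3 < t4 ->
  exists p, in_open_segment (circle_point c n t1) (circle_point c n t3) p /\
            in_open_segment (circle_point c n t2) (circle_point c n t4) p.
Proof.
move=> t12 t23 t34.
pose m (x y z : R) := (y - x) * (z - x) * (z - y).
have m_gt0 x y z : x < y -> y < z -> 0 < m x y z.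
  by move=> xy yz; rewrite /m !mulr_gt0 ?subr_gt0 //; apply: lt_trans yz.
pose q (t : R) := 1 + t ^+ 2.
have q_gt0 t : 0 < q t by rewrite ltr_pwDl ?sqr_ge0.
pose l1 := m t2 t3 t4 * q t1; pose l2 := m t1 t3 t4 * q t2.
pose l3 := m t1 t2 t4 * q t3; pose l4 := m t1 t2 t3 * q t4.
have t13 := lt_trans t12 t23; have t24 := lt_trans t23 t34.
have l1_gt0 : 0 < l1 by rewrite mulr_gt0 ?m_gt0.
have l2_gt0 : 0 < l2 by rewrite mulr_gt0 ?m_gt0.
have l3_gt0 : 0 < l3 by rewrite mulr_gt0 ?m_gt0.
have l4_gt0 : 0 < l4 by rewrite mulr_gt0 ?m_gt0.
(* The same affine relation, applied to 1 + t^2, which is a combination of the conic coordinates 1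
   and t^2. *)
have def_L : l1 + l3 = l2 + l4 by rewrite /l1 /l2 /l3 /l4 /m /q; ring.
have L_gt0 : 0 < l1 + l3 by rewrite addr_gt0.
have L_neq0 : l1 + l3 != 0 by rewrite gt_eqF.
have frac (a b : R) : 0 < a -> 0 < b -> 0 < b / (a + b) < 1.
  move=> a0 b0; have ab0 : 0 < a + b by rewrite addr_gt0.
  by rewrite divr_gt0 //= ltr_pdivrMr // mul1r ltrDr.
have weigh (a b x y : R) : 0 < a -> 0 < b ->
    (1 - b / (a + b)) * x + b / (a + b) * y = (a * x + b * y) / (a + b).
  by move=> a0 b0; field; rewrite gt_eqF ?addr_gt0.
have balance (n0 u v : R) (P := fun t => n0 + 2 * (u + t * v) / q t) :
    l1 * P t1 + l3 * P t3 = l2 * P t2 + l4 * P t4.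
  have lP a t : a * q t * P t = a * q t * n0 + 2 * a * (u + t * v).
    by rewrite /P; field; rewrite gt_eqF.
  by rewrite !lP /m /q; ring.
exists ((1 - l3 / (l1 + l3)) * (circle_point c n t1).1 +
          l3 / (l1 + l3) * (circle_point c n t3).1,
        (1 - l3 / (l1 + l3)) * (circle_point c n t1).2 +
          l3 / (l1 + l3) * (circle_point c n t3).2).
split; first by exists (l3 / (l1 + l3)); rewrite ?frac.
exists (l4 / (l2 + l4)); rewrite ?frac // !weigh // def_L /=.
rewrite -!mulrN; congr pair; congr (_ / _).
  by have := balance n.1 (c.1 - n.1) (- (c.2 - n.2)); rewrite /q !mulrN.
exact: balance.
Qed.

End CircleParametrization.

(** * Numbering the vertices along the circle *)

Section Drawing.
Variables (R : realType) (G : sgraph) (d : convex_drawing R G).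

(** Pigeonhole: the points at horizontal offset r/(i + 1) from the center are distinct, so the
    vertices cannot occupy |G| + 1 of them. *)
Lemma free_point :
  exists2 n, on_circle (center d) (radius d) n & forall v, d v <> n.
Proof.
pose c := center d; pose r := radius d; have r_gt0 : 0 < r := radius_gt0 d.
pose x (i : nat) := r / i.+1%:R.
pose pt i := (c.1 + x i, c.2 + Num.sqrt (r ^+ 2 - x i ^+ 2)).
have on_pt i : on_circle c r (pt i).
  rewrite /on_circle /pt /=.
  have -> : c.1 + x i - c.1 = x i by ring.
  have -> (z : R) : c.2 + z - c.2 = z by ring.
  have x_ge0 : 0 <= x i by rewrite divr_ge0 // ltW.
  rewrite sqr_sqrtr ?subrKC // subr_ge0 lerXn2r ?nnegrE ?(ltW r_gt0) //.
  by rewrite ler_pdivrMr // ler_pMr // ler1n.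
have [[i free]|hit] := pselect (exists i, forall v, d v <> pt i).
  by exists (pt i).
have {}hit i : exists v, d v = pt i.
  by apply: contrapT => no_v; apply: hit; exists i => v dv; apply: no_v; exists v.
have [f def_f] := choice hit.
have f_inj : injective (fun i : 'I_#|G|.+1 => f i).
  move=> i j eq_f; apply/val_inj => /=.
  have := def_f i; rewrite eq_f def_f => -[/addrI + _].
  move=> /(mulfI (lt0r_neq0 r_gt0))/invr_inj/eqP; rewrite eqr_nat => /eqP[<-].
  by [].
by have := leq_card _ f_inj; rewrite card_ord ltnn.
Qed.

Lemma edge_ends_inj (h : G -> nat) (x y : G * G) :
  (h x.1 < h x.2)%N -> (h y.1 < h y.2)%N ->
  [set x.1; x.2] = [set y.1; y.2] -> x = y.
Proof.
case: x y => [a b] [a' b'] /= ab ab' eq_set.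
have: a \in [set a'; b'] by rewrite -eq_set set21.
have: b \in [set a'; b'] by rewrite -eq_set set22.
have: b' \in [set a; b] by rewrite eq_set set22.
rewrite !inE => /orP[]/eqP ? /orP[]/eqP ? /orP[]/eqP ?; subst=> //; lia.
Qed.

(** Projecting from a free point of the circle gives each vertex a real parameter; [h] is its rank,
    so interleaved ranks mean interleaved parameters. *)
Lemma cyclic_index : exists2 h : G -> nat, injective h &
  forall u v x y, (h u < h v)%N -> (h x < h y)%N ->
    straddles (h u) (h v) (h x) (h y) -> crosses d [set u; v] [set x; y].
Proof.
have [n on_n free] := free_point.
have [t def_d] := choice (fun v =>
  circle_pointP (radius_gt0 d) on_n (pos_on_circle d v) (free v)).
pose below v := [set u | t u < t v]; pose h v := #|below v|.
have h_lt u v : t u < t v -> (h u < h v)%N.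
  move=> uv; apply/proper_card/properP; split.
    by apply/subsetP => w; rewrite !inE => /lt_trans; apply.
  by exists u; rewrite !inE ?ltxx.
have h_inj : injective h.
  move=> u v; case: (ltgtP (t u) (t v)) => [/h_lt|/h_lt|eq_t _].
  - by move=> + eq_h; rewrite eq_h ltnn.
  - by move=> + eq_h; rewrite eq_h ltnn.
  - by apply: (@pos_inj _ _ d); rewrite !def_d eq_t.
have t_lt u v : (h u < h v)%N -> t u < t v.
  move=> uv; case: (ltgtP (t u) (t v)) => // [/h_lt vu|eq_t].
    by have := ltn_trans uv vu; rewrite ltnn.
  by rewrite /h /below eq_t ltnn in uv.
exists h => // u v x y uv xy s; split.
  move=> eq_e; have /eqP := @edge_ends_inj h (u, v) (x, y) uv xy eq_e.
  rewrite xpair_eqE => /andP[/eqP eu /eqP ev]; move: s.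
  by rewrite /straddles -eu -ev; lia.
case/orP: s => [/andP[/andP[ux xv] vy]|/andP[xu /andP[uy yv]]].
  have [p [p_uv p_xy]] := circle_point_crossing (center d) n
    (t_lt _ _ ux) (t_lt _ _ xv) (t_lt _ _ vy).
  by exists p; split; [exists u, v | exists x, y]; rewrite !def_d.
have [p [p_xy p_uv]] := circle_point_crossing (center d) n
  (t_lt _ _ xu) (t_lt _ _ uy) (t_lt _ _ yv).
by exists p; split; [exists u, v | exists x, y]; rewrite !def_d.
Qed.

End Drawing.

(** * The bound for outer k-planar graphs *)

Theorem theorem13 (R : realType) (k : nat) (G : sgraph) :
  outer_k_planar R G k ->
  (treewidth G)%:R <= 3%:R / 2%:R * k%:R + 2%:R :> rat.
Proof.
case=> d planar_d; have [h h_inj h_cross] := cyclic_index d.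
have tw : (treewidth G <= (3 * k + 4)./2)%N.
  apply: (treewidth_le_crossnum h_inj) => u v uv lt_uv.
  have e_uv : [set u; v] \in edges G by apply/imsetP; exists (u, v); rewrite ?inE.
  apply: leq_trans (planar_d _ e_uv); rewrite /crossnum ecount_card.
  (* Passes from ordered pairs to edges as two-element sets; this is injective since [h] orders each
     pair. *)
  pose ends (x : G * G) := [set x.1; x.2].
  rewrite -(card_in_imset (f := ends)) => [|x y].
    apply/subset_leq_card/subsetP => _ /imsetP[x + ->].
    rewrite !inE => /andP[/andP[adj_x lt_x] s]; apply/andP; split.
      by apply/imsetP; exists x; rewrite ?inE.
    by apply/asboolP; apply: h_cross.
  rewrite !inE => /andP[/andP[_ x_lt] _] /andP[/andP[_ y_lt] _].
  exact: (@edge_ends_inj _ h).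
have {}tw : (2 * treewidth G <= 3 * k + 4)%N by lia.
have: (2 * treewidth G)%:R <= (3 * k + 4)%:R :> rat by rewrite ler_nat.
rewrite natrD !natrM; lra.
Qed.
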